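(* Let $P:\{\pm1\}^k\to[0,1]$ be a generalized predicate. Produce a CSP over $\pm1$-valued variables $x_1,\dots,x_n$ with $m=\Delta n$ randomly chosen $P$-constraints (each $P$ applied to an independent uniformly random ordered $k$-tuple of distinct variables). Replace each variable $x_i$ by a block of $R$ copies $x_i^{(1)},\dots,x_i^{(R)}$, replace each constraint $P(x_{i_1},\dots,x_{i_k})$ by all $R^k$ constraints $P(x_{i_1}^{(j_1)},\dots,x_{i_k}^{(j_k)})$, and impose the close-to-balanced constraint $\left|\mathrm{avg}_{i\in[n],j\in[R]}x_i^{(j)}\right|\le\zeta$; call the resulting CSP $\mathbf{C}$, whose objective value is the average value of $P$ over its constraints. Then with high probability the optimum objective value of $\mathbf{C}$ is at most $\mathbb{E}[P]+\eta$, where $\eta=O\!\left(\sqrt{\frac{\log(k\Delta)}{\Delta}}+\sqrt k\,\zeta+\frac{k^2}{n}\right)$.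
   Context: $\mathbb{E}[P]$ denotes the mean of $P$ under the uniform distribution on $\{\pm1\}^k$.
   Formalization: The formal theorem requires kΔ ≥ c for a fixed c > 1, with the O-constant depending only on c; without this the bound fails (k=1, Δ=1, ζ=0, P(x)=(1+x)/2) or log(kΔ) is negative. *)

(* Defs.v *)
From HB Require Import structures.
From mathcomp Require Import all_boot all_order all_algebra.
From mathcomp Require Import all_classical all_reals all_analysis.

Set Implicit Arguments.
Unset Strict Implicit.
Unset Printing Implicit Defensive.

Import Order.TTheory GRing.Theory Num.Theory.
Import numFieldNormedType.Exports.

Local Open Scope ring_scope.

Definition avg (R : realType) (T : finType) (f : T -> R) : R :=
  (\sum_(x : T) f x) / #|T|%:R.

(* Probability of the event A when x is uniform on the finite type T. *)
Definition unif_prob (R : realType) (T : finType) (A : pred T) : R :=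
  #|A|%:R / #|T|%:R.

(* The two-element set {1, -1} is encoded as bool: b stands for (-1) ^+ b, i.e.
   false for 1 and true for -1. *)
Definition sign_val (R : realType) (b : bool) : R := (-1) ^+ b.

(* A generalized predicate P : {1, -1}^k -> [0, 1]. *)
Definition generalized_predicate (R : realType) (k : nat)
    (P : {ffun 'I_k -> bool} -> R) : Prop :=
  forall z, 0 <= P z <= 1.

Section CSP.
Context (R : realType) (k : nat) (V E : finType).

(* Variables are indexed by V and constraints by E; the constraint e is P
   applied to the variables scope e 0, ..., scope e (k - 1). *)
Variables (P : {ffun 'I_k -> bool} -> R) (scope : E -> 'I_k -> V).

Definition objective (x : {ffun V -> bool}) : R :=
  avg (fun e : E => P [ffun l => x (scope e l)]).

Definition close_to_balanced (zeta : R) (x : {ffun V -> bool}) : bool :=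
  `|avg (fun v : V => sign_val R (x v))| <= zeta.

(* The values of a generalized predicate are nonnegative, so the default 0 only
   matters when no assignment is close to balanced (e.g. #|V| odd, zeta = 0). *)
Definition optimum (zeta : R) : R :=
  \big[Num.max/0]_(x : {ffun V -> bool} | close_to_balanced zeta x) objective x.

End CSP.

Definition distinct_tuple (k n : nat) := {t : k.-tuple 'I_n | uniq t}.

(* The uniform distribution on this type is that of m independent uniformly
   random ordered k-tuples of distinct variables. *)
Definition random_scopes (m k n : nat) := {ffun 'I_m -> distinct_tuple k n}.

(* The variable (i, j) is the j-th copy of the i-th original variable; the
   constraint (a, j) applies P to the copies j 0, ..., j (k - 1) of the
   successive variables of the original constraint a. *)
Definition blowup (m k n r : nat) (S : random_scopes m k n)
    (e : 'I_m * {ffun 'I_k -> 'I_r}) (l : 'I_k) : 'I_n * 'I_r :=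
  (tnth (val (S e.1)) l, e.2 l).

(* Main.v *)
(* Choosing uniformly at random one copy of each variable turns an assignment of
   the blown-up CSP into an assignment of the original one. Since the variables
   of a constraint are distinct, the expected value of the original CSP is the
   blown-up value. So it suffices to control the 2^n assignments of the original
   CSP, whether balanced or not: by a Chernoff bound and a union bound, with
   probability 1 - 2^-n each of them has value at most its expectation over a
   random distinct k-tuple, plus O(sqrt (log (k Delta) / Delta)). Averaging back
   over the choice of copies and replacing distinct tuples by independent ones
   (cost k^2 / n) leaves the mean of P under a product of k bits of bias
   mu, |mu| <= zeta, which is within O(sqrt k |mu|) of E[P] by a chi-square
   estimate. *)
Require Import Defs.
From HB Require Import structures.
From mathcomp Require Import all_boot all_order all_algebra.
From mathcomp Require Import all_classical all_reals all_analysis.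
From mathcomp Require Import ring lra.

Set Implicit Arguments.
Unset Strict Implicit.
Unset Printing Implicit Defensive.

Import Order.TTheory GRing.Theory Num.Theory.
Import numFieldNormedType.Exports.

Local Open Scope classical_set_scope.
Local Open Scope ring_scope.

(** * Averages over finite types and uniform probability *)

Section Averages.
Context {R : realType}.

Lemma eq_avg (T : finType) (f g : T -> R) : f =1 g -> avg f = avg g.
Proof. by move=> fg; rewrite /avg (eq_bigr g). Qed.

Lemma le_avg (T : finType) (f g : T -> R) :
  (forall x, f x <= g x) -> avg f <= avg g.
Proof. by move=> fg; rewrite ler_wpM2r ?invr_ge0 ?ler0n// ler_sum. Qed.

Lemma avg_cst (T : finType) (a : R) : (0 < #|T|)%N -> avg (fun _ : T => a) = a.
Proof.
by move=> T0; rewrite /avg sumr_const -[a *+ _]mulr_natr mulfK// pnatr_eq0 -lt0n.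
Qed.

Lemma avgD (T : finType) (f g : T -> R) :
  avg (fun x => f x + g x) = avg f + avg g.
Proof. by rewrite /avg big_split mulrDl. Qed.

Lemma avgZ (T : finType) (a : R) (f : T -> R) :
  avg (fun x => a * f x) = a * avg f.
Proof. by rewrite /avg -mulr_sumr mulrA. Qed.

Lemma avgB (T : finType) (f g : T -> R) :
  avg (fun x => f x - g x) = avg f - avg g.
Proof. by rewrite /avg sumrB mulrBl. Qed.

Lemma avg_ge0 (T : finType) (f : T -> R) : (forall x, 0 <= f x) -> 0 <= avg f.
Proof. by move=> f0; rewrite mulr_ge0 ?invr_ge0// sumr_ge0. Qed.

Lemma avg_le1 (T : finType) (f : T -> R) :
  (0 < #|T|)%N -> (forall x, f x <= 1) -> avg f <= 1.
Proof. by move=> T0 f1; rewrite -(avg_cst 1 T0); exact: le_avg. Qed.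

Lemma avg_pair (T U : finType) (f : T * U -> R) :
  avg f = avg (fun x => avg (fun y => f (x, y))).
Proof.
rewrite /avg card_prod natrM invfM mulrA -mulr_suml mulrAC; congr (_ * _ / _).
by rewrite pair_bigA; apply: eq_bigr => -[].
Qed.

Lemma exchange_avg (T U : finType) (f : T -> U -> R) :
  avg (fun x => avg (f x)) = avg (fun y => avg (f^~ y)).
Proof. by rewrite /avg -!mulr_suml exchange_big/= mulrAC. Qed.

Lemma avg_bij (T U : finType) (h : T -> U) (f : U -> R) :
  bijective h -> avg (fun x => f (h x)) = avg f.
Proof.
move=> bh; rewrite /avg (bij_eq_card bh); congr (_ / _).
by rewrite [RHS](reindex h)//; exact: onW_bij.
Qed.

Lemma avg_ffun_prod (I T : finType) (g : I -> T -> R) :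
  avg (fun s : {ffun I -> T} => \prod_i g i (s i)) = \prod_i avg (g i).
Proof.
rewrite /avg card_ffun -bigA_distr_bigA big_split/= prodr_const natrX.
by rewrite exprVn.
Qed.

(* The restriction of a uniform family to distinct indices is uniform. *)
Lemma avg_comp_ffun (I J T : finType) (t : J -> I) (g : {ffun J -> T} -> R) :
  injective t -> (0 < #|T|)%N ->
  avg (fun s : {ffun I -> T} => g [ffun l => s (t l)]) = avg g.
Proof.
move=> tinj T0.
(* Law of the restricted family: the indicator of [j] factors over [I]. By injectivity of [t] each
   fibre has at most one [l]; an index in the image contributes [1 / #|T|], any other an empty
   product. *)
have marg (j : {ffun J -> T}) :
    avg (fun s : {ffun I -> T} => (j == [ffun l => s (t l)])%:R : R)
    = (#|{ffun J -> T}|%:R)^-1.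
  transitivity (avg (fun s : {ffun I -> T} =>
      \prod_i \prod_(l | t l == i) (j l == s i)%:R) : R).
    apply: eq_avg => s.
    transitivity (\prod_l (j l == s (t l))%:R : R); last first.
      rewrite (partition_big t predT)//=; apply: eq_bigr => i _.
      by apply: eq_bigr => l /eqP ->.
    rewrite -natr_prod; congr (_%:R); case: eqP => [->|ne].
      by rewrite big1// => l _; rewrite ffunE eqxx.
    case: (pickP (fun l => j l != s (t l))) => [l /negbTE nl|all0].
      by rewrite (bigD1 l)//= nl.
    case: ne; apply/ffunP => l; rewrite ffunE.
    by have /negbFE/eqP := all0 l.
  rewrite (avg_ffun_prod (fun i v => \prod_(l | t l == i) (j l == v)%:R)).
  rewrite card_ffun natrX -exprVn -(card_codom tinj) -prodr_const big_mkcond/=.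
  rewrite [RHS]big_mkcond; apply: eq_bigr => i _.
  case: ifPn => [/codomP[l ->]|ni].
    rewrite /avg -[RHS]mul1r; congr (_ / _).
    have tl v : \prod_(l' | t l' == t l) (j l' == v)%:R = (j l == v)%:R :> R.
      by rewrite (big_pred1 l)// => l'; rewrite /= (inj_eq tinj).
    rewrite (bigD1 (j l))//= tl eqxx big1 ?addr0// => v ne.
    by rewrite tl eq_sym (negbTE ne).
  rewrite -[RHS](avg_cst 1 T0); apply: eq_avg => v.
  rewrite big_pred0// => l; apply/eqP => tl.
  by move: ni; rewrite -tl codom_f.
transitivity (avg (fun s : {ffun I -> T} =>
    \sum_j g j * (j == [ffun l => s (t l)])%:R)).
  apply: eq_avg => s; rewrite (bigD1 [ffun l => s (t l)])//= eqxx mulr1.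
  by rewrite big1 ?addr0// => j /negbTE ->; rewrite mulr0.
rewrite {1}/avg exchange_big/= mulr_suml [RHS]/avg mulr_suml.
apply: eq_bigr => j _; by rewrite -(marg j) -avgZ.
Qed.

(** The difference of the two sides is the variance of [f]. *)
Lemma sqr_avg_le (T : finType) (f : T -> R) :
  (0 < #|T|)%N -> avg f ^+ 2 <= avg (fun x => f x ^+ 2).
Proof.
move=> T0; rewrite -subr_ge0.
have -> : avg (fun x => f x ^+ 2) - avg f ^+ 2
    = avg (fun x => (f x - avg f) ^+ 2).
  transitivity (avg (fun x => (f x ^+ 2 + (- 2 * avg f) * f x) + avg f ^+ 2)).
    by rewrite !avgD avgZ avg_cst//; ring.
  by apply: eq_avg => x; ring.
by apply: avg_ge0 => x; exact: sqr_ge0.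
Qed.

Lemma unif_probE (T : finType) (A : pred T) :
  unif_prob R A = avg (fun x => (A x)%:R).
Proof.
rewrite /unif_prob /avg -sum1_card natr_sum big_mkcond/=; congr (_ / _).
by apply: eq_bigr => x _; rewrite unfold_in; case: (A x).
Qed.

Lemma unif_prob_setC (T : finType) (A : pred T) :
  (0 < #|T|)%N -> unif_prob R A = 1 - unif_prob R (fun x => ~~ A x).
Proof.
move=> T0; rewrite !unif_probE -[X in X - _](avg_cst 1 T0) -avgB.
by apply: eq_avg => x; case: (A x) => /=; rewrite ?subr0 ?subrr.
Qed.

Lemma le_unif_prob (T : finType) (A B : pred T) :
  (forall x, A x -> B x) -> unif_prob R A <= unif_prob R B.
Proof.
move=> AB; rewrite !unif_probE; apply: le_avg => x; rewrite ler_nat.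
by case: (A x) (AB x) => // ->.
Qed.

Lemma unif_prob_exists (T X : finType) (A : X -> pred T) :
  unif_prob R (fun s => [exists x, A x s]) <= \sum_x unif_prob R (A x).
Proof.
under eq_bigr do rewrite unif_probE.
rewrite /avg -mulr_suml exchange_big/= unif_probE; apply: le_avg => s.
case: existsP => [[x Ax]|_]; last exact: sumr_ge0.
by rewrite (bigD1 x)//= Ax lerDl sumr_ge0.
Qed.

End Averages.

(** * Concentration of an average of independent samples *)

Section Concentration.
Context {R : realType}.

(** From [1 - u <= expR (- u)], since [(1 - u) (1 + u + 2 u^2) = 1 + u^2 (1 - 2 u)]. *)
Lemma expR_le_quad (u : R) : u <= 2^-1 -> expR u <= 1 + u + 2 * u ^+ 2.
Proof.
move=> u2; have := expR_ge1Dx (- u); rewrite expRN => h.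
have e0 := expR_gt0 u.
have h1 : (1 - u) * expR u <= 1.
  by have := ler_wpM2r (ltW e0) h; rewrite mulVf ?gt_eqF.
rewrite -(@ler_pM2l _ (1 - u)); last lra.
apply: (le_trans h1).
have : 0 <= u ^+ 2 * (1 - 2 * u) by rewrite mulr_ge0 ?sqr_ge0//; lra.
nra.
Qed.

Lemma chernoff (m : nat) (T : finType) (f : T -> R) (tau : R) :
  (0 < m)%N -> (0 < #|T|)%N -> (forall t, 0 <= f t <= 1) -> 0 <= tau ->
  unif_prob R (fun s : {ffun 'I_m -> T} => avg f + tau < avg (fun a => f (s a)))
  <= expR (- (m%:R * tau ^+ 2 / 8)).
Proof.
move=> m0 T0 f01 tau0.
have m0' : (0 : R) < m%:R by rewrite ltr0n.
have cardm : (0 < #|'I_m|)%N by rewrite card_ord.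
have Ef0 : 0 <= avg f by apply: avg_ge0 => t; case/andP: (f01 t).
(* For [tau > 1] the event is empty, as averages of [f] lie in [0, 1]. The bound [tau <= 1] later
   keeps the exponent [s * (f t - avg f)] below 1/2. *)
case: (leP tau 1) => [tau1|tau1]; last first.
  rewrite unif_probE (@eq_avg _ _ _ (fun _ => 0)) => [|s].
    by rewrite /avg big1// mul0r expR_ge0.
  rewrite ltNge (le_trans (avg_le1 _ _))//; first by move=> a; case/andP: (f01 (s a)).
  lra.
(* The exponent 2 s^2 - s tau is minimal at this s, with value - tau^2 / 8. *)
pose s := tau / 4.
have s0 : 0 <= s by rewrite /s; lra.
rewrite unif_probE.
(* Markov's inequality in exponential form; independence then turns the average of the product into
   an [m]-th power. *)
apply: (@le_trans _ _ (avg (fun S : {ffun 'I_m -> T} =>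
    \prod_a expR (s * (f (S a) - avg f) - s * tau)))).
  apply: le_avg => S; rewrite -expR_sum; case: ltP => [lt|_]; last exact: expR_ge0.
  rewrite -[leLHS]expR0 ler_expR.
  have -> : \sum_a (s * (f (S a) - avg f) - s * tau)
      = m%:R * (s * (avg (fun a => f (S a)) - (avg f + tau))).
    transitivity (m%:R * avg (fun a => s * (f (S a) - avg f) - s * tau)).
      by rewrite /avg card_ord [RHS]mulrC divfK// gt_eqF.
    by rewrite avgB avgZ avgB !avg_cst//; ring.
  by rewrite mulr_ge0// mulr_ge0// subr_ge0 ltW.
rewrite (avg_ffun_prod (fun _ t => expR (s * (f t - avg f) - s * tau))).
rewrite prodr_const card_ord.
have -> : - (m%:R * tau ^+ 2 / 8) = (2 * s ^+ 2 - s * tau) *+ m.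
  by rewrite -[RHS]mulr_natl /s; field.
rewrite -[X in expR X]mulr_natl expRM_natl.
apply: lerXn2r; rewrite ?nnegrE ?expR_ge0//.
  by apply: avg_ge0 => t; exact: expR_ge0.
under eq_avg do rewrite expRD mulrC.
rewrite avgZ mulrC expRD ler_wpM2r ?expR_ge0//.
(* The linear term averages to 0, and [(f t - avg f)^2 <= 1]. *)
apply: (@le_trans _ _ (avg (fun t => (1 + s * (f t - avg f)) + 2 * s ^+ 2))).
  apply: le_avg => t; have /andP[ft0 ft1] := f01 t.
  have Ef1 : avg f <= 1 by apply: avg_le1 => // t'; case/andP: (f01 t').
  apply: (le_trans (expR_le_quad _)); first by rewrite /s; nra.
  rewrite lerD2l ler_pM2l// exprMn ler_piMr ?sqr_ge0//.
  rewrite -subr_ge0 -[X in X - _](expr1n _ 2) subr_sqr mulr_ge0//; lra.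
rewrite !avgD avgZ avgB !avg_cst// subrr mulr0 addr0.
exact: expR_ge1Dx.
Qed.

End Concentration.

(** * Distinct tuples, biased bits and the blown-up objective *)

Section Blowup.
Context {R : realType}.

(** Birthday bound on the chance that [k] independent indices collide, by induction on [k]. *)
Lemma ffact_ge (n k : nat) : (k <= n)%N -> (0 < n)%N ->
  (1 - k%:R ^+ 2 / n%:R) * n%:R ^+ k <= (n ^_ k)%:R :> R.
Proof.
move=> + n0; have n0' : (0 : R) < n%:R by rewrite ltr0n.
elim: k => [|k IH] kn; first by rewrite expr0n mul0r subr0 ffactn0 expr0 mulr1.
rewrite ffactnSr natrM natrB 1?ltnW//.
have kn' : k%:R <= n%:R - 1 :> R by rewrite lerBrDr natr1 ler_nat.
have k0 : (0 : R) <= k%:R by [].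
have nk0 : 0 <= n%:R - k%:R :> R by lra.
apply: le_trans (ler_wpM2r nk0 (IH (ltnW kn))).
have M0 : 0 <= n%:R ^+ k :> R by exact: exprn_ge0.
rewrite -[k.+1%:R]natr1 -subr_ge0.
have -> : (1 - k%:R ^+ 2 / n%:R) * n%:R ^+ k * (n%:R - k%:R)
    - (1 - (k%:R + 1) ^+ 2 / n%:R) * n%:R ^+ k.+1
    = n%:R ^+ k * (k%:R ^+ 3 + n%:R * (k%:R + 1)) / n%:R :> R.
  by rewrite [_ ^+ k.+1]exprS; set M := n%:R ^+ k; field; rewrite gt_eqF.
by rewrite !(mulr_ge0, addr_ge0, invr_ge0, exprn_ge0).
Qed.

Lemma card_distinct_tuple (k n : nat) : #|{: distinct_tuple k n}| = (n ^_ k)%N.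
Proof.
rewrite card_sig -[in RHS](card_ord n) -card_uniq_tuples.
rewrite cardsE; apply: eq_card => t; rewrite !inE unfold_in.
by rewrite (introT allP).
Qed.

(** Distinct tuples embed into all maps, so their sum of [g >= 0] is smaller; only the normalization
    changes, and averages at most 1 make this an additive loss. *)
Lemma avg_distinct_le (k n : nat) (g : {ffun 'I_k -> 'I_n} -> R) :
  (k <= n)%N -> (0 < n)%N -> (forall h, 0 <= g h <= 1) ->
  avg (fun t : distinct_tuple k n => g [ffun l => tnth (val t) l])
  <= avg g + k%:R ^+ 2 / n%:R.
Proof.
move=> kn n0 g01; set h := fun t : distinct_tuple k n => _.
have g0 z : 0 <= g z by case/andP: (g01 z).
have n0' : (0 : R) < n%:R by rewrite ltr0n.
have N0 : (0 < #|{: distinct_tuple k n}|)%N by rewrite card_distinct_tuple ffact_gt0.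
have a1 : avg h <= 1 by apply: avg_le1 => // t; case/andP: (g01 [ffun l => tnth (val t) l]).
have a0 : 0 <= avg h by apply: avg_ge0 => t; exact: g0.
have sum_le : \sum_t h t <= \sum_z g z.
  pose e (t : distinct_tuple k n) := [ffun l => tnth (val t) l].
  have einj : injective e.
    move=> t u /ffunP tu; apply/val_inj/eq_from_tnth => l.
    by have := tu l; rewrite !ffunE.
  rewrite -(big_imset g (h := e) (A := predT))/=; last by move=> ? ? _ _ /einj.
  by rewrite [leRHS](bigID [in e @: predT])/= lerDl sumr_ge0.
have M0 : 0 < n%:R ^+ k :> R by rewrite exprn_gt0.
have avgg : avg g = (\sum_z g z) / n%:R ^+ k by rewrite /avg card_ffun !card_ord natrX.
have hsum : \sum_t h t = avg h * (n ^_ k)%:R.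
  by rewrite -card_distinct_tuple /avg divfK// pnatr_eq0 -lt0n.
rewrite -lerBlDr avgg ler_pdivlMr//; apply: le_trans sum_le.
rewrite hsum; apply: le_trans (ler_wpM2l a0 (ffact_ge kn n0)).
rewrite mulrA; apply: ler_wpM2r; first exact: ltW.
rewrite mulrBr mulr1 lerB// ler_piMl// divr_ge0// exprn_ge0//.
Qed.

Lemma avg_bool (f : bool -> R) : avg f = (f true + f false) / 2.
Proof. by rewrite /avg card_bool big_bool. Qed.

(** Change of measure: the excess over [avg P] is the average of [P (L - 1)], bounded by the root of
    the chi-square distance [(1 + mu^2)^k - 1]. *)
Lemma avg_biased_le (k : nat) (V : finType) (P : {ffun 'I_k -> bool} -> R)
    (x : V -> bool) :
  (0 < #|V|)%N -> generalized_predicate P ->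
  avg (fun v : {ffun 'I_k -> V} => P [ffun l => x (v l)])
  <= avg P + 2 * (Num.sqrt k%:R * `|avg (fun v => sign_val R (x v))|).
Proof.
move=> V0 P01; set mu := avg (fun v => sign_val R (x v)).
have P0 z : 0 <= P z by case/andP: (P01 z).
have P1 z : P z <= 1 by case/andP: (P01 z).
pose w b : R := 1 + sign_val R b * mu.
(* L is the density of k independent bits of bias mu with respect to the uniform
   distribution; its second moment is (1 + mu^2)^k. *)
pose L (z : {ffun 'I_k -> bool}) : R := \prod_l w (z l).
have wE b : avg (fun v : V => (x v == b)%:R) = w b / 2.
  transitivity (avg (fun v : V => 2^-1 * (1 + sign_val R b * sign_val R (x v)))).
    apply: eq_avg => v; rewrite /sign_val.
    by case: (x v) b => -[]; rewrite ?expr0 ?expr1 /=; field.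
  by rewrite avgZ avgD avgZ avg_cst// mulrC.
have lhsE : avg (fun v : {ffun 'I_k -> V} => P [ffun l => x (v l)])
    = avg (fun z => P z * L z).
  transitivity (\sum_z P z *
      avg (fun v : {ffun 'I_k -> V} => \prod_l (x (v l) == z l)%:R : R)).
    under eq_bigr do rewrite -avgZ.
    rewrite /avg -mulr_suml exchange_big/=; congr (_ / _).
    apply: eq_bigr => v _; rewrite (bigD1 [ffun l => x (v l)])//=.
    rewrite [X in _ = _ * X + _]big1 => [|l _]; last by rewrite ffunE eqxx.
    rewrite mulr1 big1 ?addr0// => z zx.
    suff [l xz] : exists l, x (v l) != z l.
      by rewrite (bigD1 l)//= (negbTE xz) mul0r mulr0.
    apply/existsP; apply: contra_neqT zx => /existsPn xz.
    by apply/ffunP => l; rewrite ffunE; have /negPn/eqP-> := xz l.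
  rewrite [RHS]/avg card_ffun card_bool card_ord natrX mulr_suml.
  apply: eq_bigr => z _; rewrite -mulrA; congr (_ * _).
  rewrite (avg_ffun_prod (fun l v => (x v == z l)%:R)).
  under eq_bigr do rewrite wE.
  by rewrite big_split/= prodr_const card_ord exprVn.
have lhs1 : avg (fun z => P z * L z) <= 1.
  rewrite -lhsE; apply: avg_le1 => [|v]; last exact: P1.
  by rewrite card_ffun expn_gt0 V0.
have ffun0 : (0 < #|{ffun 'I_k -> bool}|)%N by rewrite card_ffun card_bool expn_gt0.
set B := 2 * _.
have B0 : 0 <= B by rewrite /B !mulr_ge0 ?sqrtr_ge0.
have B2 : B ^+ 2 = 4 * (k%:R * mu ^+ 2).
  rewrite -[mu ^+ 2]real_normK ?num_real//.
  by rewrite -[X in _ = _ * (X * _)](@sqr_sqrtr _ k%:R)// /B; ring.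
have km0 : 0 <= k%:R * mu ^+ 2 by rewrite mulr_ge0// sqr_ge0.
(* If [k mu^2 > 1/2] then [B^2 > 2], so [B > 1] and the trivial bound 1 suffices. *)
rewrite lhsE; case: (leP (k%:R * mu ^+ 2) 2^-1) => km; last first.
  apply: (le_trans lhs1).
  have AP0 : 0 <= avg P by apply: avg_ge0.
  nra.
rewrite -lerBlDl -avgB.
under eq_avg do rewrite -[X in _ - X]mulr1 -mulrBr.
have L1 : avg L = 1.
  rewrite /L (avg_ffun_prod (fun=> w)) big1// => l _.
  by rewrite avg_bool /w /sign_val expr0 expr1; field.
have L2 : avg (fun z => L z ^+ 2) = (1 + mu ^+ 2) ^+ k.
  under eq_avg do rewrite /L -prodrXl.
  rewrite (avg_ffun_prod (fun _ b => w b ^+ 2)) prodr_const card_ord.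
  by congr (_ ^+ _); rewrite avg_bool /w /sign_val expr0 expr1; field.
apply: (le_trans (ler_norm _)); rewrite -ler_sqr ?nnegrE// real_normK ?num_real//.
apply: (le_trans (sqr_avg_le _ ffun0)).
apply: (@le_trans _ _ (avg (fun z => (L z ^+ 2 + (- 2) * L z) + 1))).
  apply: le_avg => z; rewrite exprMn.
  have -> : L z ^+ 2 + (- 2) * L z + 1 = (L z - 1) ^+ 2 by ring.
  by rewrite ler_piMl ?sqr_ge0// exprn_ile1.
rewrite !avgD avgZ avg_cst// L1 L2 B2.
have : (1 + mu ^+ 2) ^+ k <= expR (k%:R * mu ^+ 2).
  rewrite expRM_natl; apply: lerXn2r; rewrite ?nnegrE ?expR_ge0 ?expR_ge1Dx//.
  by rewrite addr_ge0// sqr_ge0.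
(* With [u = k mu^2 <= 1/2]: [expR u - 1 <= u + 2 u^2 <= 2 u <= B^2]. *)
have := expR_le_quad km.
nra.
Qed.

(** The deterministic half: scopes on which no assignment of the original CSP overshoots its mean by
    more than [tau] are good for every blown-up assignment. *)
Lemma objective_blowup_le (k n m r : nat) (P : {ffun 'I_k -> bool} -> R)
    (S : random_scopes m k n) (tau : R) (x : {ffun 'I_n * 'I_r -> bool}) :
  generalized_predicate P -> (k <= n)%N -> (0 < n)%N -> (0 < r)%N ->
  let f (y : {ffun 'I_n -> bool}) (t : distinct_tuple k n) :=
    P [ffun l => y (tnth (val t) l)] in
  (forall y, avg (fun a => f y (S a)) <= avg (f y) + tau) ->
  objective P (blowup S) x
  <= avg P + tau
     + 2 * (Num.sqrt k%:R * `|avg (fun v => sign_val R (x v))|)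
     + k%:R ^+ 2 / n%:R.
Proof.
move=> P01 kn n0 r0 f good.
have cr : (0 < #|'I_r|)%N by rewrite card_ord.
pose g (h : {ffun 'I_k -> 'I_n}) :=
  avg (fun j : {ffun 'I_k -> 'I_r} => P [ffun l => x (h l, j l)]).
pose y (s : {ffun 'I_n -> 'I_r}) : {ffun 'I_n -> bool} := [ffun i => x (i, s i)].
(* One copy is drawn per variable; as [t] has distinct entries, the copies seen by a constraint are
   independent. *)
have marg (t : distinct_tuple k n) :
    avg (fun s => f (y s) t) = g [ffun l => tnth (val t) l].
  have tinj : injective (tnth (val t)) by apply/tuple_uniqP; exact: (valP t).
  rewrite /g -(avg_comp_ffun _ tinj cr); apply: eq_avg => s; congr P.
  by apply/ffunP => l; rewrite !ffunE.
rewrite /objective avg_pair.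
have -> : avg (fun a => avg (fun j => P [ffun l => x (blowup S (a, j) l)]))
    = avg (fun s => avg (fun a => f (y s) (S a))).
  rewrite [RHS]exchange_avg; apply: eq_avg => a; rewrite marg; apply: eq_avg => j.
  by congr P; apply/ffunP => l; rewrite !ffunE.
apply: (@le_trans _ _ (avg (fun s => avg (f (y s)) + tau))); first exact: le_avg.
rewrite avgD avg_cst ?card_ffun ?card_ord ?expn_gt0 ?r0//.
rewrite exchange_avg (eq_avg marg).
have g01 h : 0 <= g h <= 1.
  apply/andP; split; first by apply: avg_ge0 => j; case/andP: (P01 [ffun l => x (h l, j l)]).
  apply: avg_le1 => [|j]; last by case/andP: (P01 [ffun l => x (h l, j l)]).
  by rewrite card_ffun !card_ord expn_gt0 r0.
(* Independent indices and copies amount to [k] independent uniform variables of the blow-up, whose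
   bias is the balance of [x]. *)
have Eg : avg g = avg (fun v : {ffun 'I_k -> 'I_n * 'I_r} => P [ffun l => x (v l)]).
  rewrite /g -(avg_pair (fun p : {ffun 'I_k -> 'I_n} * {ffun 'I_k -> 'I_r} =>
    P [ffun l => x (p.1 l, p.2 l)])).
  pose s (v : {ffun 'I_k -> 'I_n * 'I_r}) : {ffun 'I_k -> 'I_n} * {ffun 'I_k -> 'I_r} :=
    ([ffun l => (v l).1], [ffun l => (v l).2]).
  rewrite -(@avg_bij _ _ _ s); last first.
    exists (fun p : {ffun 'I_k -> 'I_n} * {ffun 'I_k -> 'I_r} =>
      [ffun l => (p.1 l, p.2 l)]) => [v|[p q]].
      by apply/ffunP => l; rewrite !ffunE -surjective_pairing.
    by congr pair; apply/ffunP => l; rewrite !ffunE.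
  apply: eq_avg => v; congr P; apply/ffunP => l.
  by rewrite !ffunE -surjective_pairing.
have nr0 : (0 < #|{: 'I_n * 'I_r}|)%N by rewrite card_prod !card_ord muln_gt0 n0.
have := avg_biased_le x nr0 P01; rewrite -Eg.
have := avg_distinct_le kn n0 g01.
lra.
Qed.

End Blowup.

Theorem theorem13 (R : realType) (c : R) (hc : 1 < c) :
  exists (C : R) (delta : nat -> R),
    [/\ 0 < C,
        delta n @[n --> \oo] --> (0 : R)
      & forall (k n m r : nat) (Delta zeta : R) (P : {ffun 'I_k -> bool} -> R),
          generalized_predicate P ->
          (k <= n)%N ->
          (0 < r)%N ->
          m%:R = Delta * n%:R ->
          c <= k%:R * Delta ->
          0 <= zeta ->
          let eta := C * (Num.sqrt (ln (k%:R * Delta) / Delta)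
                          + Num.sqrt k%:R * zeta
                          + k%:R ^+ 2 / n%:R) in
          1 - delta n <=
            unif_prob R (fun S : random_scopes m k n =>
              optimum P (blowup (r := r) S) zeta <= avg P + eta)].
Proof.
(* C0 is such that m tau^2 / 8 >= 2 n for tau = C0 sqrt (ln (k Delta) / Delta),
   so the Chernoff bound expR (- 2 n) <= 4^-n beats the union over 2^n. *)
pose C0 : R := Num.sqrt (16 / ln c).
have lnc : 0 < ln c by exact: ln_gt0.
have C00 : 0 <= C0 by exact: sqrtr_ge0.
have C0sq : C0 ^+ 2 = 16 / ln c by rewrite sqr_sqrtr// divr_ge0// ltW.
(* [C0] pays for the deviation [tau], [2] for the bias term; [2^-n] is [2^n] assignments times
   [4^-n]. *)
exists (C0 + 2), (fun n => 2^-1 ^+ n); split.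
- by lra.
- apply: cvg_expr; rewrite ger0_norm; lra.
move=> k n m r Delta zeta P P01 kn r0 mE ckD zeta0; cbv zeta.
set eta := (C0 + 2) * _.
have k0 : (0 < k)%N.
  by rewrite lt0n; apply: contraTN ckD => /eqP ->; rewrite mul0r -ltNge; lra.
have n0 : (0 < n)%N := leq_trans k0 kn.
have n0' : (0 : R) < n%:R by rewrite ltr0n.
have k0' : (0 : R) < k%:R by rewrite ltr0n.
have kD0 : 0 < k%:R * Delta by lra.
have D0 : 0 < Delta by rewrite pmulr_rgt0 in kD0.
have m0 : (0 < m)%N by rewrite -(ltr0n R) mE mulr_gt0.
have lnkD : ln c <= ln (k%:R * Delta) by rewrite ler_ln ?posrE//; lra.
pose q := Num.sqrt (ln (k%:R * Delta) / Delta).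
have q0 : 0 <= q by exact: sqrtr_ge0.
have q2 : q ^+ 2 = ln (k%:R * Delta) / Delta by rewrite sqr_sqrtr// divr_ge0//; lra.
pose tau := C0 * q.
have tau0 : 0 <= tau by exact: mulr_ge0.
have kz0 : 0 <= Num.sqrt k%:R * zeta by rewrite mulr_ge0 ?sqrtr_ge0.
have kn0 : 0 <= k%:R ^+ 2 / n%:R :> R by rewrite divr_ge0// exprn_ge0.
have eta_ge : tau + 2 * (Num.sqrt k%:R * zeta) + k%:R ^+ 2 / n%:R <= eta.
  rewrite /eta -/q /tau.
  have : 0 <= C0 * (Num.sqrt k%:R * zeta) by exact: mulr_ge0.
  have : 0 <= C0 * (k%:R ^+ 2 / n%:R) by exact: mulr_ge0.
  nra.
have AP0 : 0 <= avg P by apply: avg_ge0 => z; case/andP: (P01 z).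
have N0 : (0 < #|{: distinct_tuple k n}|)%N by rewrite card_distinct_tuple ffact_gt0.
pose f (y : {ffun 'I_n -> bool}) (t : distinct_tuple k n) :=
  P [ffun l => y (tnth (val t) l)].
pose bad (y : {ffun 'I_n -> bool}) (S : random_scopes m k n) :=
  avg (f y) + tau < avg (fun a => f y (S a)).
have tail : \sum_y unif_prob R (bad y) <= 2^-1 ^+ n.
  have bound y : unif_prob R (bad y) <= 4^-1 ^+ n.
    apply: le_trans (chernoff m0 N0 (fun t => P01 _) tau0) _.
    have -> : m%:R * tau ^+ 2 / 8 = n%:R * (2 * (ln (k%:R * Delta) / ln c)).
      rewrite mE /tau exprMn C0sq q2; field.
      by rewrite !gt_eqF.
    rewrite -mulrN expRM_natl; apply: lerXn2r; rewrite ?nnegrE ?expR_ge0 ?invr_ge0//.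
    rewrite expRN lef_pV2 ?posrE ?expR_gt0//.
    (* [4 <= expR 1 ^+ 2] since [2 <= expR 1]; the ratio of logarithms is at least 1 because
       [c <= k Delta]. *)
    apply: (@le_trans _ _ (expR 1 ^+ 2)).
      have : 2 <= expR 1 :> R by have := expR_ge1Dx (1 : R); lra.
      nra.
    rewrite -expRM_natl mulr1 ler_expR ler_peMr// ler_pdivlMr// mul1r.
    exact: lnkD.
  apply: (le_trans (ler_sum _ (fun y _ => bound y))).
  rewrite sumr_const card_ffun card_bool card_ord -[leLHS]mulr_natl natrX -exprMn.
  have -> : 2 * 4^-1 = 2^-1 :> R by field.
  exact: lexx.
rewrite unif_prob_setC; last first.
  by rewrite card_ffun expn_gt0 N0.
rewrite lerD2l lerN2; apply: le_trans tail.
apply: le_trans (unif_prob_exists bad); apply: le_unif_prob => S.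
apply: contraNT => /existsPn good; rewrite /optimum.
(* The default 0 of the maximum satisfies the bound because [avg P] and [eta] are nonnegative. *)
apply: (big_ind (fun u => u <= avg P + eta)) => [|u v uP vP|x xbal]; first by lra.
  by rewrite ge_max uP.
have goodS y : avg (fun a => f y (S a)) <= avg (f y) + tau by rewrite leNgt; exact: good.
apply: (le_trans (objective_blowup_le _ P01 kn n0 r0 goodS)).
have : Num.sqrt k%:R * `|avg (fun v => sign_val R (x v))| <= Num.sqrt k%:R * zeta.
  by rewrite ler_wpM2l ?sqrtr_ge0.
lra.
Qed.
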